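(* Fix integers $s\geq 2$, $t\geq 2$ and $k\geq 1$. Then \[ \mathrm{La}(n,K_{s,t},\#P_k)=O\!\left(n\binom{n}{\lfloor n/2\rfloor}\right)=O\!\left(\sqrt{n}\,2^n\right) \] as $n\to\infty$ (with implied constants depending on $s,t,k$).
   Context: $2^{[n]}$ is the Boolean lattice of all subsets of $[n]=\{1,\dots,n\}$ ordered by inclusion. A poset $P$ is a (weak) subposet of a poset $Q$ if there is an injection $f:P\to Q$ such that $p\le_P p'$ implies $f(p)\le_Q f(p')$. A family $\mathcal{F}\subseteq 2^{[n]}$ is $P$-free if $P$ is not a weak subposet of $(\mathcal{F},\subseteq)$. $P_k$ denotes the chain on $k$ elements; a copy of $P_k$ in $\mathcal{F}$ is a chain $F_1\subsetneq\cdots\subsetneq F_k$ of members of $\mathcal{F}$. $\mathrm{La}(n,P,\#Q)$ is the maximum number of copies of $Q$ in a $P$-free family $\mathcal{F}\subseteq 2^{[n]}$. For positive integers $s,t$, the poset $K_{s,t}$ has $s$ minimal elements and $t$ maximal elements, and every minimal element is less than every maximal element. *)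

(* Defs.v *)
From HB Require Import structures.
From mathcomp Require Import all_boot all_order.

Set Implicit Arguments.
Unset Strict Implicit.
Unset Printing Implicit Defensive.

Import Order.Theory.
Local Open Scope order_scope.

Definition weak_subposet (d d' : Order.disp_t) (P : finPOrderType d)
    (Q : finPOrderType d') : bool :=
  [exists f : {ffun P -> Q},
    injectiveb f && [forall x, forall y, (x <= y) ==> (f x <= f y)]].

Lemma weak_subposetP (d d' : Order.disp_t) (P : finPOrderType d)
    (Q : finPOrderType d') :
  reflect (exists2 f : P -> Q, injective f & {homo f : x y / x <= y})
          (weak_subposet P Q).
Proof.
apply: (iffP existsP) => [[f /andP[/injectiveP inj_f /forallP homo_f]]|].
  by exists f => // x y; have /forallP/(_ y)/implyP := homo_f x.
move=> [f inj_f homo_f]; exists [ffun x => f x]; apply/andP; split.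
  by apply/injectiveP => x y; rewrite !ffunE; apply: inj_f.
by apply/forallP => x; apply/forallP => y; apply/implyP; rewrite !ffunE => /homo_f.
Qed.

Fact inclusion_display : Order.disp_t. Proof. exact. Qed.

(* A family F of subsets of [n] (the ground set being 'I_n), seen as the poset
   of its members ordered by inclusion. *)
Definition family_poset (n : nat) (F : {set {set 'I_n}}) : Type :=
  {A : {set 'I_n} | A \in F}.

HB.instance Definition _ (n : nat) (F : {set {set 'I_n}}) :=
  SubFinite.copy (family_poset F) {A : {set 'I_n} | A \in F}.

Definition family_le (n : nat) (F : {set {set 'I_n}}) (A B : family_poset F) :
  bool := val A \subset val B.

Fact family_le_refl (n : nat) (F : {set {set 'I_n}}) :
  reflexive (@family_le n F).
Proof. by move=> A; apply: subxx. Qed.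

Fact family_le_anti (n : nat) (F : {set {set 'I_n}}) :
  antisymmetric (@family_le n F).
Proof. by move=> A B leAB; apply/val_inj/eqP; rewrite eqEsubset. Qed.

Fact family_le_trans (n : nat) (F : {set {set 'I_n}}) :
  transitive (@family_le n F).
Proof. by move=> B A C; apply: subset_trans. Qed.

HB.instance Definition _ (n : nat) (F : {set {set 'I_n}}) :=
  Order.Le_isPOrder.Build inclusion_display (family_poset F)
    (@family_le_refl n F) (@family_le_anti n F) (@family_le_trans n F).

Definition poset_free (d : Order.disp_t) (P : finPOrderType d) (n : nat)
    (F : {set {set 'I_n}}) : bool :=
  ~~ weak_subposet P (family_poset F).

(* Copies of the chain P_k in F: sequences F_1 < ... < F_k of members of F,
   strictly increasing for inclusion. *)
Definition chains (k n : nat) (F : {set {set 'I_n}}) :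
    {set k.-tuple {set 'I_n}} :=
  [set c : k.-tuple {set 'I_n} |
    all [in F] c && sorted (fun A B : {set 'I_n} => A \proper B) c].

(* La(n, P, #P_k) *)
Definition La_chain (d : Order.disp_t) (n : nat) (P : finPOrderType d)
    (k : nat) : nat :=
  (\max_(F : {set {set 'I_n}} | poset_free P F) #|chains k F|)%N.

(* K_{s,t}: the summand 'I_s carries the minimal elements, 'I_t the maximal
   ones. *)
Definition K (s t : nat) : Type := ('I_s + 'I_t)%type.

HB.instance Definition _ (s t : nat) := Finite.copy (K s t) ('I_s + 'I_t)%type.

Definition K_le (s t : nat) (x y : K s t) : bool :=
  (x == y) || (match x, y with inl _, inr _ => true | _, _ => false end).

Fact K_le_refl (s t : nat) : reflexive (@K_le s t).
Proof. by move=> x; rewrite /K_le eqxx. Qed.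

Fact K_le_anti (s t : nat) : antisymmetric (@K_le s t).
Proof.
by move=> [x|x] [y|y]; rewrite /K_le ?orbF => /andP[] // /eqP.
Qed.

Fact K_le_trans (s t : nat) : transitive (@K_le s t).
Proof.
move=> [y|y] [x|x] [z|z]; rewrite /K_le ?orbF ?orbT //.
- by move=> /eqP-> /eqP->.
- by move=> /eqP-> /eqP->.
Qed.

Fact K_display : Order.disp_t. Proof. exact. Qed.

HB.instance Definition _ (s t : nat) :=
  Order.Le_isPOrder.Build K_display (K s t)
    (@K_le_refl s t) (@K_le_anti s t) (@K_le_trans s t).

(* Main.v *)
(** Fix a [K_{s,t}]-free family [F]. Every set [X] has at most [s] members of
    [F] below it or at most [t] members of [F] above it, for otherwise [X] would
    separate the two sides of a copy of [K_{s,t}]. The sets of the first kind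
    form a down-set [L]. If [L] contains the whole ground set then [F] has at
    most [s] members, and if it misses the empty set then [F] has at most [t]
    members. Otherwise every chain of [F] extends to a chain from the empty set
    to the ground set, hence leaves [L] through an edge [(X, x |: X)] of the
    cube: its members are below [X] or above [x |: X], so that each such edge
    accounts for at most [(s + t) ^ k] chains. The number of edges leaving a
    down-set [L] is [\sum_(X in L) (n - 2 |X|)], which is largest when [L]
    consists of the sets of size at most [n / 2]; the sum then telescopes to
    [uphalf n * 'C(n, n./2)]. *)
Require Import Defs.
From mathcomp Require Import all_boot all_order zify.
Set Implicit Arguments.
Unset Strict Implicit.
Unset Printing Implicit Defensive.

Lemma leq_ffact_expn m n k : m <= n -> m ^_ k <= n ^ k.
Proof.
move=> le_mn; rewrite ffact_prod -[k in n ^ k]card_ord -prod_nat_const.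
by apply: leq_prod => i _; apply: leq_trans (leq_subr _ _) le_mn.
Qed.

Lemma bin_double_succ m : 'C(m.+1.*2, m.+1) = 2 * 'C(m.*2.+1, m).
Proof.
have bin_symm : 'C(m.*2.+1, m.+1) = 'C(m.*2.+1, m).
  by rewrite -bin_sub; [congr 'C(_, _) |]; lia.
by rewrite doubleS binS bin_symm; lia.
Qed.

Lemma mul_bin_double_succ m :
  m.+1 * 'C(m.+1.*2, m.+1) = 2 * (m.*2.+1 * 'C(m.*2, m)).
Proof.
rewrite bin_double_succ mulnCA; congr (2 * _).
by rewrite (mul_bin_down m.*2.+1 m); congr (_ * _); lia.
Qed.

Lemma leq_bin_double_sqr m : m.*2.+1 * 'C(m.*2, m) ^ 2 <= 16 ^ m.
Proof.
elim: m => // m IHm.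
have bin_rec : m.+1 ^ 2 * 'C(m.+1.*2, m.+1) ^ 2
    = 4 * m.*2.+1 * (m.*2.+1 * 'C(m.*2, m) ^ 2).
  by rewrite -expnMn mul_bin_double_succ !expnMn; lia.
have amgm : 4 * (m.+1.*2.+1 * m.*2.+1) <= m.+1 ^ 2 * 16.
  have := nat_AGM2 m.+1.*2.+1 m.*2.+1.
  by have -> : m.+1.*2.+1 + m.*2.+1 = m.+1 * 4; [lia | rewrite expnMn => -[]].
rewrite -(@leq_pmul2l (m.+1 ^ 2)) ?expn_gt0 // mulnCA bin_rec (expnS 16).
by rewrite mulnA [leqRHS]mulnA leq_mul // mulnCA.
Qed.

Lemma leq_bin_half_sqr n : n * 'C(n, n./2) ^ 2 <= 4 ^ n.
Proof.
have exp4_double m : 4 ^ m.*2 = 16 ^ m by rewrite -mul2n expnM.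
rewrite -{1 2 4}(odd_double_half n); case: (odd n); set m := n./2.
  have := leq_bin_double_sqr m.+1.
  rewrite bin_double_succ expnMn (expnS 16) add1n (expnS 4) exp4_double.
  by move: ('C(_, _) ^ 2) (16 ^ m) => c p; nia.
rewrite add0n exp4_double.
by apply: leq_trans (leq_bin_double_sqr m); rewrite leq_mul2r leqnSn orbT.
Qed.

Lemma sum_bin_sub_double n j : j.*2 <= n.+2 ->
  \sum_(0 <= i < j) 'C(n, i) * (n - i.*2) = j * 'C(n, j).
Proof.
elim: j => [|j IHj] le_jn; first by rewrite big_nil.
rewrite big_nat_recr //= IHj; last by lia.
by rewrite mul_bin_left (mulnC 'C(_, _)) -mulnDl; congr (_ * _); lia.
Qed.

Lemma sum_bin_sub_double_half n :
  \sum_(0 <= i < n.+1) 'C(n, i) * (n - i.*2) = uphalf n * 'C(n, n./2).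
Proof.
rewrite (@big_cat_nat _ _ _ n./2.+1) //=; last by lia.
rewrite [X in _ + X]big_nat [X in _ + X]big1 => [|i]; last first.
  by move=> /andP[lt_half_i _]; have -> : n - i.*2 = 0; [lia | rewrite muln0].
rewrite addn0 sum_bin_sub_double ?mul_bin_left; last by lia.
by congr (_ * _); lia.
Qed.

Lemma leq_card_bigcup (I T : finType) (A : {pred I}) (S : I -> {set T}) b :
  {in A, forall i, #|S i| <= b} -> #|\bigcup_(i in A) S i| <= #|A| * b.
Proof.
move=> leSb; rewrite -sum_nat_const.
apply: leq_trans (leq_sum _ leSb); elim/big_rec2: _ => [|i m U _ leU].
  by rewrite cards0.
by apply: leq_trans (leq_card_setU _ _) _; rewrite leq_add2l.
Qed.

Lemma card_dep_pairs (I J : finType) (A : {pred I}) (B : I -> {set J}) :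
  #|[set p : I * J | (p.1 \in A) && (p.2 \in B p.1)]| = \sum_(i in A) #|B i|.
Proof.
under [RHS]eq_bigr do rewrite -sum1_card.
by rewrite pair_big_dep -sum1_card; apply: eq_bigl => p; rewrite inE.
Qed.

Section BooleanLattice.
Variable T : finType.
Implicit Types (X Y A B : {set T}) (F L : {set {set T}}).

Lemma sum_card_set (f : nat -> nat) :
  \sum_(X : {set T}) f #|X| = \sum_(0 <= i < #|T|.+1) 'C(#|T|, i) * f i.
Proof.
rewrite big_mkord.
rewrite (partition_big (fun X : {set T} => inord #|X| : 'I_#|T|.+1) predT) //=.
apply: eq_bigr => i _; rewrite -card_draws -sum_nat_const.
have card_ltS X : #|X| < #|T|.+1 by rewrite ltnS max_card.
apply: eq_big => [X|X /eqP <-]; last by rewrite inordK.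
by rewrite inE -val_eqE /= inordK.
Qed.

Definition down_set L : Prop :=
  forall X Y, X \subset Y -> Y \in L -> X \in L.

Definition edge_boundary L : {set {set T} * T} :=
  [set p | [&& p.1 \in L, p.2 \notin p.1 & p.2 |: p.1 \notin L]].

(* Among the cube edges going up from [L], those that stay inside the down-set
   [L] are the edges going down from [L]. *)
Lemma card_edge_boundary_down_set L : down_set L ->
  \sum_(X in L) #|X| + #|edge_boundary L| = \sum_(X in L) #|~: X|.
Proof.
move=> downL.
rewrite -(card_dep_pairs (mem L) id) -(card_dep_pairs _ (@setC T)).
rewrite -[RHS](cardsID [set p | p.2 |: p.1 \in L]); congr (_ + _); last first.
  by apply: eq_card => p; rewrite !inE andbA [RHS]andbC.
rewrite -!sum1_card.
rewrite (reindex_onto (fun p => (p.2 |: p.1, p.2))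
                      (fun p => (p.1 :\ p.2, p.2))).
  apply: eq_bigl => -[X x]; rewrite !inE /= xpair_eqE !eqxx !andbT.
  have [xX|xX] := boolP (x \in X); last first.
    rewrite setU1K // eqxx !andbT andb_idl //.
    exact: downL (subsetUr _ _).
  rewrite andbF; apply/negP => /andP[_ /eqP eqX].
  by rewrite -eqX !inE eqxx in xX.
by move=> [X x]; rewrite !inE /= => /andP[_ xX]; rewrite setD1K.
Qed.

Lemma leq_card_edge_boundary L : down_set L ->
  #|edge_boundary L| <= uphalf #|T| * 'C(#|T|, #|T|./2).
Proof.
move=> /card_edge_boundary_down_set card_L.
rewrite -(leq_add2l (\sum_(X in L) #|X|)) card_L.
rewrite -sum_bin_sub_double_half -(sum_card_set (fun i => #|T| - i.*2)).
rewrite [X in _ <= _ + X](bigID (mem L)) /= addnA -big_split /=.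
apply: leq_trans (leq_addr _ _); apply: leq_sum => X _.
by rewrite -(leq_add2l #|X|) cardsC; move: #|X| #|T| => i m; lia.
Qed.

Lemma edge_boundary_between L A B : A \subset B -> A \in L -> B \notin L ->
  exists2 p, p \in edge_boundary L & (A \subset p.1) && (p.2 |: p.1 \subset B).
Proof.
move=> AB AL BL; pose between X := (X \in L) && (X \subset B).
have betweenA : between A by rewrite /between AL.
have [X /maxsetP[/andP[XL XB] maxX] AX] := maxset_exists betweenA.
have /properP[_ [x xB xX]] : X \proper B.
  by rewrite properEneq XB andbT; apply: contraNneq BL => <-.
have xXB : x |: X \subset B by rewrite subUset sub1set xB.
exists (X, x); last by rewrite /= AX.
rewrite inE /= XL xX /=; apply: contra xX => xXL.
by rewrite -(maxX (x |: X)) ?setU11 ?subsetUr // /between xXL.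
Qed.

Lemma path_cross_edge_boundary L A (c : seq {set T}) :
  A \in L -> setT \notin L -> path (fun X Y => X \subset Y) A c ->
  exists2 p, p \in edge_boundary L &
    (A \subset p.1) &&
    all (fun X => (X \subset p.1) || (p.2 |: p.1 \subset X)) c.
Proof.
move=> AL TL; elim: c A AL => [|B c IHc] A AL /=.
  have [p pL /andP[Ap _]] := edge_boundary_between (subsetT A) AL TL.
  by exists p; rewrite ?Ap.
move=> /andP[AB Bc]; have [BL|BL] := boolP (B \in L).
  have [p pL /andP[Bp cp]] := IHc B BL Bc.
  by exists p; rewrite // Bp (subset_trans AB Bp).
have [p pL /andP[Ap pB]] := edge_boundary_between AB AL BL.
exists p; rewrite // Ap pB orbT /=.
have /allP Bsub := order_path_min (fun _ _ _ => @subset_trans _ _ _ _) Bc.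
by apply/allP => X /Bsub BX; rewrite (subset_trans pB BX) orbT.
Qed.

Definition members_above F X : {set {set T}} := [set A in F | X \subset A].

Lemma down_set_few_below F b : down_set [set X | #|F ::&: X| <= b].
Proof.
move=> X Y XY; rewrite !inE; apply: leq_trans.
by apply/subset_leq_card/subsetP => A; rewrite !inE => /andP[-> /subset_trans->].
Qed.

End BooleanLattice.

Lemma leq_card_chains k n (F : {set {set 'I_n}}) b :
  #|F| <= b -> #|chains k F| <= b ^ k.
Proof.
move=> /(leq_ffact_expn k); apply: leq_trans; rewrite -card_uniq_tuples.
apply/subset_leq_card/subsetP => c; rewrite !inE => /andP[-> c_sorted].
by apply: sorted_uniq c_sorted => [A B C|A];
  [apply: proper_trans | apply: properxx].
Qed.

Lemma chains_cross_edge_boundary k n (F L : {set {set 'I_n}}) :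
  set0 \in L -> setT \notin L ->
  chains k F \subset \bigcup_(p in edge_boundary L)
    chains k (F ::&: p.1 :|: members_above F (p.2 |: p.1)).
Proof.
move=> L0 LT; apply/subsetP => c; rewrite inE => /andP[/allP cF c_sorted].
have c_path : path (fun A B : {set 'I_n} => A \subset B) set0 c.
  rewrite path_min_sorted; last by apply/allP => A _; apply: sub0set.
  by apply: sub_sorted c_sorted => A B /proper_sub.
have [p pL /andP[_ /allP cp]] := path_cross_edge_boundary L0 LT c_path.
apply/bigcupP; exists p; rewrite // inE c_sorted andbT.
by apply/allP => A cA; rewrite /= !inE (cF A cA) (cp A cA).
Qed.

Lemma leq_card_chains_edge_boundary k n (F L : {set {set 'I_n}}) a b :
  {in L, forall X, #|F ::&: X| <= a} ->
  (forall X, X \notin L -> #|members_above F X| <= b) ->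
  #|chains k F| <= maxn 1 #|edge_boundary L| * (a + b) ^ k.
Proof.
move=> le_a le_b.
have [/(leq_card_chains k) few_chains|large_F] := leqP #|F| (a + b).
  by apply: leq_trans few_chains _; rewrite leq_pmull ?leq_maxl.
have LT : setT \notin L.
  apply: contraL large_F => /le_a; rewrite -setI_powerset powersetT setIT.
  by rewrite -leqNgt => /leq_trans; apply; apply: leq_addr.
have L0 : set0 \in L.
  have above0 : members_above F set0 = F.
    by apply/setP => A; rewrite inE sub0set andbT.
  apply: contraTT large_F => /le_b; rewrite above0.
  by rewrite -leqNgt => /leq_trans; apply; apply: leq_addl.
apply: leq_trans (subset_leq_card (chains_cross_edge_boundary k F L0 LT)) _.
apply: (@leq_trans (#|edge_boundary L| * (a + b) ^ k)).
  apply: leq_card_bigcup => p; rewrite inE => /and3P[pL _ pnL].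
  apply: leq_card_chains; apply: leq_trans (leq_card_setU _ _) _.
  exact: leq_add (le_a _ pL) (le_b _ pnL).
by rewrite leq_mul2r leq_maxr orbT.
Qed.

Lemma weak_subposet_K s t n (F A B : {set {set 'I_n}}) :
  A \subset F -> B \subset F -> [disjoint A & B] ->
  {in A & B, forall X Y : {set 'I_n}, X \subset Y} ->
  s <= #|A| -> t <= #|B| -> weak_subposet (K s t) (family_poset F).
Proof.
move=> AF BF disjAB subAB le_sA le_tB.
pose embed (x : K s t) : {set 'I_n} :=
  match x with
  | inl i => enum_val (widen_ord le_sA i)
  | inr j => enum_val (widen_ord le_tB j)
  end.
have embedA i : embed (inl i) \in A by apply: enum_valP.
have embedB j : embed (inr j) \in B by apply: enum_valP.
have embedF x : embed x \in F.
  by case: x => [i|j]; [apply: (subsetP AF) | apply: (subsetP BF)].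
have embed_neq i j : embed (inl i) <> embed (inr j).
  by move=> ij; have := disjointFr disjAB (embedA i); rewrite ij embedB.
have embed_inj : injective embed.
  by move=> [i|i] [j|j] => [|/embed_neq|/esym/embed_neq|] // /enum_val_inj;
    move=> /(congr1 val)/= /val_inj ->.
apply/weak_subposetP.
exists (fun x => Sub (embed x) (embedF x) : family_poset F).
  by move=> x y /(congr1 val) /embed_inj.
move=> x y /orP[/eqP -> //|]; case: x y => [i|i] [j|j] // _.
exact: subAB (embedA i) (embedB j).
Qed.

(* The bound is [s] rather than [s.-1] because a member [X] of [F] lies both
   below and above itself. *)
Lemma K_free_few_below_or_above s t n (F : {set {set 'I_n}}) X :
  poset_free (K s t) F -> (#|F ::&: X| <= s) || (#|members_above F X| <= t).
Proof.
apply: contraNT; rewrite negb_or -!ltnNge => /andP[lt_s lt_t].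
apply: (@weak_subposet_K s t n F ((F ::&: X) :\ X) (members_above F X)).
- by apply/subsetP => A; rewrite !inE => /and3P[].
- by apply/subsetP => A; rewrite inE => /andP[].
- apply/pred0P => A; apply/negP; rewrite /= !inE => /andP[/and3P[AX _ sAX]].
  by move=> /andP[_ sXA]; rewrite eqEsubset sAX sXA in AX.
- move=> A B; rewrite !inE => /and3P[_ _ AX] /andP[_ XB].
  exact: subset_trans AX XB.
- by move: lt_s; rewrite (cardsD1 X); case: (_ \in _) => //= /ltnW.
- exact: ltnW.
Qed.

Lemma leq_La_chain_K s t k n : 0 < n ->
  La_chain n (K s t) k <= n * 'C(n, n./2) * (s + t) ^ k.
Proof.
move=> n_gt0; apply/bigmax_leqP => F freeF.
pose L := [set X | #|F ::&: X| <= s].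
have le_s : {in L, forall X, #|F ::&: X| <= s} by move=> X; rewrite inE.
have le_t X : X \notin L -> #|members_above F X| <= t.
  by have := K_free_few_below_or_above X freeF; rewrite inE; case: leqP.
apply: leq_trans (leq_card_chains_edge_boundary k le_s le_t) _.
have [half_leq uphalf_leq] : n./2 <= n /\ uphalf n <= n by lia.
rewrite leq_mul2r geq_max muln_gt0 n_gt0 bin_gt0 half_leq /=; apply/orP; right.
apply: leq_trans (leq_card_edge_boundary (@down_set_few_below _ F s)) _.
by rewrite card_ord leq_mul2r uphalf_leq orbT.
Qed.

(* Imported only here: [classical_sets] shadows many names of [finset]. *)
From mathcomp Require Import all_algebra all_classical all_reals all_analysis.
Import Order.TTheory GRing.Theory Num.Theory.
Import numFieldNormedType.Exports.
Local Open Scope classical_set_scope.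
Local Open Scope ring_scope.

Lemma ler_bin_half_sqrt (R : rcfType) n :
  n%:R * 'C(n, n./2)%:R <= Num.sqrt n%:R * 2 ^+ n :> R.
Proof.
rewrite -{1}(sqr_sqrtr (ler0n R n)) expr2 -mulrA ler_wpM2l ?sqrtr_ge0 //.
rewrite -(@ler_pXn2r _ 2) ?nnegrE ?mulr_ge0 ?sqrtr_ge0 ?exprn_ge0 //.
rewrite exprMn sqr_sqrtr // exprAC -!natrX -natrM ler_nat.
exact: leq_bin_half_sqr.
Qed.

Theorem theorem4 (R : realType) (s t k : nat)
    (hs : (2 <= s)%N) (ht : (2 <= t)%N) (hk : (1 <= k)%N) :
  let La := (fun n : nat => ((La_chain n (K s t) k)%:R : R) : R^o) in
  let central := (fun n : nat => (n%:R * 'C(n, n./2)%:R : R) : R^o) in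
  let root := (fun n : nat => (Num.sqrt n%:R * 2 ^+ n : R) : R^o) in
  [/\ La =O_\oo central, central =O_\oo root & La =O_\oo root].
Proof.
move=> La central root.
have La_central : La =O_\oo central.
  apply/eqO_exP; exists ((s + t) ^ k)%N%:R.
    by rewrite ltr0n expn_gt0 addn_gt0 (ltnW hs).
  exists 1%N => // n n_gt0; rewrite /La /central !ger0_norm ?mulr_ge0 //.
  by rewrite mulrC -!natrM ler_nat leq_La_chain_K.
have central_root : central =O_\oo root.
  apply/eqO_exP; exists 1 => //; exists 0%N => // n _.
  rewrite mul1r /central /root !ger0_norm ?mulr_ge0 ?sqrtr_ge0 ?exprn_ge0 //.
  exact: ler_bin_half_sqrt.
by split => //; apply: eqO_trans La_central central_root.
Qed.
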